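(* Let $k\ge2$. The generating function $\sum_{\pi}x^{|\pi|}$, where the sum is over all $132$-avoiding permutations with exactly one occurrence of the pattern $23\dots k1$, is given by $$\frac{x}{U_{k-2}\left(\frac1{2\sqrt x}\right)U_k\left(\frac1{2\sqrt x}\right)}.$$ More generally, let $1\le r\le k-1$. Then the generating function $\sum_\pi x^{|\pi|}$, where the sum is over all $132$-avoiding permutations with exactly $r$ occurrences of the pattern $23\dots k1$, is given by $$\frac{1}{U_{k-3}\left(\frac1{2\sqrt x}\right)U_k\left(\frac1{2\sqrt x}\right)}\sum_{\ell\mid r}\frac{1}{\ell+1}\binom{2\ell}{\ell}x^{\ell+\frac{r}{2\ell}-\frac12}\left(\frac{U_{k-3}\left(\frac1{2\sqrt x}\right)}{U_{k-2}\left(\frac1{2\sqrt x}\right)}\right)^{r/\ell},$$ where the sum is over the positive divisors $\ell$ of $r$.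
   Context: For a permutation $\pi=\pi_1\cdots\pi_n$ of $\{1,\dots,n\}$ and a permutation $\sigma=\sigma_1\cdots\sigma_m$ of $\{1,\dots,m\}$, an occurrence of the pattern $\sigma$ in $\pi$ is a choice of indices $i_1<\dots<i_m$ such that $\pi_{i_1}\cdots\pi_{i_m}$ is in the same relative order as $\sigma$; $\pi$ is $\sigma$-avoiding if there is no occurrence. The pattern $23\dots k1$ is the permutation of $\{1,\dots,k\}$ with $\sigma_j=j+1$ for $j<k$ and $\sigma_k=1$. $|\pi|$ denotes the number of elements permuted by $\pi$. $U_n$ denotes the $n$-th Chebyshev polynomial of the second kind, $U_n(\cos t)=\sin((n+1)t)/\sin t$.
   Formalization: The second formula is stated for k ≥ 3, because for k = 2 (so r = 1) it contains 1/U_{-1} with U_{-1} = 0; that case, after cancelling U_{k-3}, is the first formula, which is stated for all k ≥ 2. *)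

(* Defs.v *)
From HB Require Import structures.
From mathcomp Require Import all_boot all_order all_algebra all_fingroup.
From mathcomp Require Import reals trigo.
From mathcomp Require Import ring zify.

Set Implicit Arguments.
Unset Strict Implicit.
Unset Printing Implicit Defensive.

Import Order.TTheory GRing.Theory Num.Theory.

Local Open Scope ring_scope.

(* A permutation of {1, ..., n} is an element of 'S_n; positions and values   *)
(* are both shifted down by one.                                              *)

Definition occurrence (m n : nat) (sigma : 'S_m) (pi : 'S_n)
    (i : {ffun 'I_m -> 'I_n}) : bool :=
  [forall a : 'I_m, forall b : 'I_m, ((a < b) ==> (i a < i b))%N] &&
  [forall a : 'I_m, forall b : 'I_m,
     ((pi (i a) < pi (i b)) == (sigma a < sigma b))%N].

Definition occurrences (m n : nat) (sigma : 'S_m) (pi : 'S_n) : nat :=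
  #|[set i : {ffun 'I_m -> 'I_n} | occurrence sigma pi i]|.

Definition avoids (m n : nat) (sigma : 'S_m) (pi : 'S_n) : bool :=
  occurrences sigma pi == 0%N.

(* 132: fixes the first letter and exchanges the other two.                   *)
Definition pat132 : 'S_3 := tperm (inord 1) (inord 2).

(* 23...k1: [ordS] sends i to i + 1 modulo k.                                 *)
Definition pat23k1 (k : nat) : 'S_k := perm (@ordS_inj k).

Definition num_perms (k r n : nat) : nat :=
  #|[set pi : 'S_n | avoids pat132 pi & occurrences (pat23k1 k) pi == r]|.

Definition is_chebyshevU (R : realType) (n : nat) (p : {poly R}) : Prop :=
  forall t : R, sin t != 0 -> p.[cos t] = sin (n.+1%:R * t) / sin t.

(* Closed forms in sqrt x are elements of the field R(s) of rational          *)
(* functions, with s = sqrt x.                                                *)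
Definition sqrtx (R : realType) : {fraction {poly R}} := tofrac 'X.

Definition at_half_inv_sqrtx (R : realType) (p : {poly R}) :
    {fraction {poly R}} :=
  (map_poly (fun c : R => tofrac c%:P) p).[(2 * sqrtx R)^-1].

(* The series \sum_m b_m s^m equals f, in the field of formal Laurent series  *)
(* in s: writing f as p / q with p and q polynomials in s, this is the        *)
(* equality of formal power series (\sum_m b_m s^m) * q = p.                  *)
Definition is_expansion (R : realType) (b : nat -> R)
    (f : {fraction {poly R}}) : Prop :=
  exists p q : {poly R},
    [/\ q != 0, f = tofrac p / tofrac q &
        forall m : nat, \sum_(i < m.+1) b i * q`_(m - i) = p`_m].

(* The formal power series \sum_n a_n x^n equals f; as x = s ^+ 2, its        *)
(* coefficient on s ^+ m is a_(m/2) for even m and 0 for odd m.               *)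
Definition is_generating_function (R : realType) (a : nat -> nat)
    (f : {fraction {poly R}}) : Prop :=
  is_expansion (fun m => if odd m then 0 else (a m./2)%:R) f.

Lemma is_chebyshevU_inj (R : realType) (n : nat) (p q : {poly R}) :
  is_chebyshevU n p -> is_chebyshevU n q -> p = q.
Proof.
move=> hp hq; apply/eqP; rewrite -subr_eq0; apply/negPn/negP => pq0.
pose rs : seq R := [seq (i.+2%:R)^-1 | i <- iota 0 (size (p - q))].
have : (size rs < size (p - q)%R)%N.
  apply: max_poly_roots => //.
    apply/allP => _ /mapP[i _ ->].
    have h0 : 0 < (i.+2%:R : R)^-1 by rewrite invr_gt0 ltr0n.
    have h1 : (i.+2%:R : R)^-1 < 1 by rewrite invf_lt1 ?ltr0n // ltr1n.
    have h2 : -1 <= (i.+2%:R : R)^-1 <= 1.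
      by rewrite (ltW h1) (le_trans _ (ltW h0)) // lerN10.
    rewrite -[X in root _ X](acosK _) ?in_itv //=.
    have hs : sin (acos ((i.+2%:R : R)^-1)) != 0.
      rewrite sin_acos // sqrtr_eq0 -ltNge subr_gt0 expr_lt1 //.
      exact: ltW.
    by rewrite rootE hornerD hornerN hp // hq // subrr.
  rewrite map_inj_uniq ?iota_uniq // => i j /invr_inj /eqP.
  by rewrite eqr_nat => /eqP[].
by rewrite size_map size_iota ltnn.
Qed.

Fixpoint chebyshevU_pair (R : realType) (n : nat) : {poly R} * {poly R} :=
  if n is m.+1 then
    let: (p, q) := chebyshevU_pair R m in (q, 2 *: 'X * q - p)
  else (1, 2 *: 'X).

Lemma is_chebyshevU_ex (R : realType) (n : nat) :
  is_chebyshevU n (chebyshevU_pair R n).1.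
Proof.
suff: is_chebyshevU n (chebyshevU_pair R n).1 /\
      is_chebyshevU n.+1 (chebyshevU_pair R n).2 by case.
elim: n => [|n] /=.
  split=> t st; first by rewrite hornerC mul1r divff.
  rewrite hornerZ hornerX (mulr_natl t) mulr2n sinD.
  by field.
case: (chebyshevU_pair R n) => p q /= [hp hq]; split=> // t st.
rewrite hornerD hornerN hornerM hornerZ hornerX hp // hq //.
have -> : n.+3%:R * t = n.+2%:R * t + t by rewrite -(natr1 n.+2) mulrDl mul1r.
have -> : n.+1%:R * t = n.+2%:R * t - t.
  by rewrite -(natr1 n.+1) mulrDl mul1r addrK.
by rewrite sinB sinD; field.
Qed.

Lemma is_expansion_inj (R : realType) (b c : nat -> R)
    (f : {fraction {poly R}}) :
  is_expansion b f -> is_expansion c f -> b =1 c.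
Proof.
move=> [p [q [q0 -> bq]]] [p' [q' [q'0 /eqP]]].
rewrite eqr_div ?tofrac_eq0 // -!tofracM tofrac_eq => /eqP pq' cq'.
pose tr (a : nat -> R) n : {poly R} := \poly_(i < n) a i.
have trM (a : nat -> R) (u v w : {poly R}) n m : (m < n)%N ->
    (forall m, \sum_(i < m.+1) a i * u`_(m - i) = v`_m) ->
    (tr a n * (u * w))`_m = (v * w)`_m.
  move=> mn au; rewrite mulrA !coefM; apply: eq_bigr => -[j /= jm] _.
  congr (_ * _); rewrite coefM -au; apply: eq_bigr => -[i /= ij] _.
  by rewrite coef_poly ifT //; lia.
have Q0 : q * q' != 0 by rewrite mulf_neq0.
have exv : exists v, (q * q')`_v != 0.
  by exists (size (q * q')).-1; rewrite -lead_coefE lead_coef_eq0.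
case: (ex_minnP exv) => v Qv minv.
move=> i; apply/eqP; rewrite -subr_eq0; apply/eqP.
elim/ltn_ind: i => i IH.
have : ((tr b (i + v).+1 - tr c (i + v).+1) * (q * q'))`_(i + v) = 0.
  rewrite mulrBl coefB (trM _ _ _ _ _ _ (ltnSn _) bq).
  by rewrite [q * q']mulrC (trM _ _ _ _ _ _ (ltnSn _) cq') pq' subrr.
have iv : (i < (i + v).+1)%N by lia.
rewrite coefM (bigD1 (Ordinal iv)) //= big1 ?addr0 => [|[j /= jl] ne].
  rewrite coefB !coef_poly iv addKn => /eqP.
  by rewrite mulf_eq0 (negPf Qv) orbF => /eqP.
rewrite coefB !coef_poly jl.
have {ne} : j != i by apply: contraNN ne => /eqP ji; apply/eqP/val_inj.
rewrite neq_ltn => /orP[/IH -> |ij]; first by rewrite mul0r.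
have -> : (q * q')`_(i + v - j) = 0; last by rewrite mulr0.
apply/eqP; apply: contraT => /minv; lia.
Qed.

(* Main.v *)
Require Import Defs.
From HB Require Import structures.
From mathcomp Require Import all_boot all_order all_algebra all_fingroup.
From mathcomp Require Import reals trigo.
From mathcomp Require Import ring zify.

(* A nonempty 132-avoiding permutation is L n R with every letter of L above   *)
(* every letter of R. An occurrence of 23...k1 lies in L, or in R, or consists *)
(* of an increasing word of L n of length k-1 followed by a letter of R. If    *)
(* there are r <= k-1 occurrences and R is nonempty, then either L has no      *)
(* increasing word of length k-2, or none of length k-1 and exactly r / |R| of *)
(* length k-2, while R is arbitrary of size |R| dividing r. This gives a       *)
(* linear equation for the generating function, whose coefficients are the     *)
(* Catalan numbers and the generating functions G_(m,j) of the 132-avoiding    *)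
(* permutations with j occurrences of 12...m and none of 12...(m+1). The       *)
(* same decomposition gives \sum_j G_(m+1,j) y^j = 1 / (1 - x \sum_j G_(m,j)   *)
(* y^j), which the Chebyshev recurrence and Cassini's identity                 *)
(* U_m^2 - U_(m+1) U_(m-1) = 1 solve in closed form.                           *)

Set Implicit Arguments.
Unset Strict Implicit.
Unset Printing Implicit Defensive.

Import Order.TTheory GRing.Theory Num.Theory.

(** * Increasing subsequences and occurrences of 23...k1 *)

(** Put x = s^2 and W_m = U_(m-1)(1/(2s)), with W_0 = 0. Cutting a 132-avoiding word at its maximum
    is a bijection onto pairs of smaller such words ([perm_av_succ]); [inc_join] and [occ_join]
    describe how increasing words and occurrences of the pattern distribute over the two factors.

    For the pattern of length k+2 and 1 <= r <= k+1, [num_occ_succ] yields for the wanted series H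
    the equation H = x H + x G_(k,0) H + x sum_(l | r) G_(k,r/l) C_l x^l. The three terms are: empty
    right factor; left factor without increasing words of length k; right factor of size l dividing
    r. In the last case the right factor is too short to contain the pattern, hence is arbitrary and
    counted by the Catalan number C_l ([num_av_bin]).

    By [gf_num_inc], G_(m,0) = W_m / (s W_(m+1)), and for j >= 1 the series G_(m,j) are geometric in
    j with ratio s W_m / W_(m+1). Two Chebyshev steps give 1 - x (1 + G_(k,0)) = x W_(k+3) /
    W_(k+1), so H = W_(k+1) / W_(k+3) sum_(l | r) G_(k,r/l) C_l x^l ([gf_num_occ]), which is the
    theorem after rearrangement. [num_permsE] passes from permutations to words. *)

Section Subsequences.

Variable T : eqType.
Implicit Types (s u v : seq T) (P : pred (seq T)).

(** Sets of positions are enumerated, so a word appears once per way of selecting it and [count]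
    over this list counts occurrences. *)
Fixpoint subs (m : nat) s {struct s} : seq (seq T) :=
  if m is m'.+1 then
    if s is x :: s' then [seq x :: u | u <- subs m' s'] ++ subs m s' else [::]
  else [:: [::]].

Lemma subs0 s : subs 0 s = [:: [::]]. Proof. by case: s. Qed.

Lemma mem_subs m s u : (u \in subs m s) = (size u == m) && subseq u s.
Proof.
elim: s m u => [|x s IH] [|m] u.
- by rewrite inE; case: u.
- by case: u => [|y u] //=; rewrite andbF.
- by rewrite subs0 inE; case: u => //= y u.
rewrite /= mem_cat; case: u => [|y u].
  by rewrite IH /= orbF; apply/mapP => -[].
rewrite IH /= eqSS; case: (y =P x) => [->|yx].
  rewrite mem_map => [|a b [] //]; rewrite IH.
  case: eqP => //= _; apply/orP/idP => [[//|h]|]; last by left.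
  exact: subseq_trans (subseq_cons _ _) h.
rewrite [X in X || _](_ : _ = false) //.
by apply/negP => /mapP[w _ [/yx]].
Qed.

Lemma subs_uniq m s : uniq s -> uniq (subs m s).
Proof.
elim: s m => [|x s IH] [|m] //= /andP[xs us].
rewrite cat_uniq map_inj_uniq ?IH // => [|a b [] //].
rewrite andbT; apply/hasPn => u; rewrite mem_subs => /andP[_ /mem_subseq/(_ x)].
move=> h; apply/mapP => -[w _ uE]; move: h; rewrite uE.
by rewrite mem_head => /(_ isT) h; rewrite h in xs.
Qed.

Lemma size_subs m s : size (subs m s) = 'C(size s, m).
Proof.
elim: s m => [|x s IH] [|m] //=.
by rewrite size_cat size_map !IH binS addnC.
Qed.

Lemma subs_size_lt m s : (size s < m)%N -> subs m s = [::].
Proof. by move=> h; apply/eqP; rewrite -size_eq0 size_subs bin_small. Qed.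

Lemma count_subs_subseq P m s u :
  subseq u s -> (count P (subs m u) <= count P (subs m s))%N.
Proof.
elim: s u m P => [|x s IH] u m P; first by move/eqP ->.
case: m => [|m]; first by rewrite !subs0.
case: u => [|y u] //=; case: eqP => [->|_] us.
  by rewrite !count_cat !count_map leq_add ?IH.
by apply: leq_trans (IH (y :: u) m.+1 P us) _; rewrite [leqRHS]count_cat leq_addl.
Qed.

Lemma count_subs_gt0P P m s :
  reflect (exists u, [/\ size u = m, subseq u s & P u])
          (0 < count P (subs m s))%N.
Proof.
rewrite -has_count; apply: (iffP hasP) => [[u]|[u [su us Pu]]].
  by rewrite mem_subs => /andP[/eqP su us] Pu; exists u.
by exists u => //; rewrite mem_subs su eqxx.
Qed.

(** A choice of m positions splits uniquely into i positions in [s1] and m - i in [s2]. *)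
Lemma count_subs_cat P m s1 s2 :
  count P (subs m (s1 ++ s2)) =
  (\sum_(i < m.+1) \sum_(u <- subs i s1)
     count (fun v => P (u ++ v)) (subs (m - i) s2))%N.
Proof.
elim: s1 m P => [|x s1 IH] m P.
  by rewrite big_ord_recl /= subn0 big_seq1 big1 ?addn0 // => i _; rewrite big_nil.
case: m => [|m]; first by rewrite big_ord1 big_seq1 subnn !subs0.
rewrite /= count_cat count_map !IH [X in _ + X = _]big_ord_recl [RHS]big_ord_recl /= !subs0.
rewrite addnCA; congr addn; rewrite -big_split /=; apply: eq_bigr => i _.
by rewrite /bump /= add1n big_cat big_map subSS.
Qed.

End Subsequences.

Lemma subs_map (T T' : eqType) (f : T -> T') m s :
  subs m (map f s) = map (map f) (subs m s).
Proof.
elim: s m => [|x s IH] [|m] //=.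
by rewrite map_cat !IH -!map_comp.
Qed.

Definition inc (m : nat) (s : seq nat) : nat := count (sorted ltn) (subs m s).

(* [rotr 1] turns an occurrence of 23...k1 into an increasing word. *)
Definition occ (k : nat) (s : seq nat) : nat :=
  count (fun w => sorted ltn (rotr 1 w)) (subs k s).

Lemma inc0 s : inc 0 s = 1%N. Proof. by rewrite /inc subs0. Qed.

Lemma inc1 s : inc 1 s = size s.
Proof.
rewrite /inc (eq_in_count (a2 := predT)) ?count_predT ?size_subs ?bin1 //.
by move=> [|x [|y w]]; rewrite mem_subs.
Qed.

(** Deleting any one of the m+1 letters of an increasing word leaves an increasing word. *)
Lemma inc_lower m s : (0 < inc m.+1 s)%N -> (m.+1 <= inc m s)%N.
Proof.
case/count_subs_gt0P => u [su us Pu].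
apply: leq_trans (count_subs_subseq _ m us).
rewrite (eq_in_count (a2 := predT)) => [|w].
  by rewrite count_predT size_subs su binSn.
by rewrite mem_subs => /andP[_ /subseq_sorted] -> //; exact: ltn_trans.
Qed.

Lemma inc_succ_eq0 m s : inc m s = 0%N -> inc m.+1 s = 0%N.
Proof. by move=> h; apply/eqP; apply: contraT; rewrite -lt0n => /inc_lower; rewrite h. Qed.

(** Dropping the final letter of an occurrence, the 1 of the pattern, leaves an increasing word. *)
Lemma occ_inc k s : (0 < occ k.+1 s)%N -> (0 < inc k s)%N.
Proof.
case/count_subs_gt0P; case/lastP => [|u y] [] //.
rewrite size_rcons rotr1_rcons => -[su] us /path_sorted h.
apply/count_subs_gt0P; exists u; split => //.
exact: subseq_trans (subseq_rcons _ _) us.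
Qed.

Lemma occ_size_lt k s : (size s < k)%N -> occ k s = 0%N.
Proof. by rewrite /occ => /subs_size_lt ->. Qed.

Lemma inc_map_addn c m s : inc m (map (addn c) s) = inc m s.
Proof.
rewrite /inc subs_map count_map; apply: eq_count => u /=.
by rewrite sorted_map; apply: eq_sorted => x y /=; rewrite ltn_add2l.
Qed.

Lemma occ_map_addn c m s : occ m (map (addn c) s) = occ m s.
Proof.
rewrite /occ subs_map count_map; apply: eq_count => u /=.
by rewrite -map_rotr sorted_map; apply: eq_sorted => x y /=; rewrite ltn_add2l.
Qed.

Lemma sorted_pair (a b : nat) (w : seq nat) :
  subseq [:: a; b] w -> sorted ltn w -> (a < b)%N.
Proof.
by move=> h /(subseq_sorted ltn_trans h) /=; rewrite andbT.
Qed.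

Lemma subseq_pair_cat (a b : nat) (u v : seq nat) :
  a \in u -> b \in v -> subseq [:: a; b] (u ++ v).
Proof. by move=> au bv; rewrite -cat1s cat_subseq // sub1seq. Qed.

Lemma sorted_cat_lt (u v : seq nat) :
  {in u & v, forall x y, x < y}%N -> sorted ltn u -> sorted ltn v ->
  sorted ltn (u ++ v).
Proof.
move=> uv su sv; case: u uv su => [|x u] // uv /= su.
rewrite cat_path su; case: v uv sv => //= y v uv ->.
by rewrite uv ?mem_last ?mem_head.
Qed.

Lemma sum_ord_eq (F : nat -> nat) (n c : nat) :
  (c < n)%N -> (\sum_(i < n) (if i == c :> nat then F i else 0))%N = F c.
Proof. by move=> cn; rewrite -big_mkcond big_ord1_eq cn. Qed.

Lemma sum_nat_bool (T : Type) (P : pred T) (s : seq T) :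
  (\sum_(u <- s) (P u : nat))%N = count P s.
Proof. by rewrite -sum1_count [RHS]big_mkcond; apply: eq_bigr => u _; case: P. Qed.

(** * Counts of increasing words and occurrences in L n R *)

Section Join.

Variables (L R : seq nat) (n : nat).
Hypothesis Ln : {in L, forall x, x < n}%N.
Hypothesis RL : {in L & R, forall x y, y < x}%N.
Hypothesis Rn : {in R, forall y, y < n}%N.

(** The letters of R lie below n and below all of L, so an increasing word that meets R stays inside
    R. *)
Lemma inc_join m :
  inc m.+1 (L ++ n :: R) = (inc m.+1 L + inc m L + inc m.+1 R)%N.
Proof.
rewrite [LHS]/inc count_subs_cat.
(* Here i is the number of letters taken from L. The conditionals are added rather than nested
   because the last two coincide at i = 0 when m = 0. *)
pose G (i : nat) : nat :=
  ((if i == m.+1 then inc i L else 0) + (if i == m then inc i L else 0)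
     + (if i == 0 then inc m.+1 R else 0))%N.
rewrite (eq_bigr (fun i : 'I_m.+2 => G i)) => [|[i /= im] _].
  rewrite !big_split /=; congr (_ + _ + _)%N; first exact: (sum_ord_eq (inc^~ L)).
    exact: (sum_ord_eq (inc^~ L)).
  exact: (sum_ord_eq (fun=> inc m.+1 R)).
have incE : \sum_(u <- subs i L) (sorted ltn u : nat) = inc i L.
  exact: sum_nat_bool.
have uL u : u \in subs i L -> size u = i /\ {subset u <= L}.
  by rewrite mem_subs => /andP[/eqP ? /mem_subseq].
rewrite /G; have [iE|im'] : i = m.+1 \/ (i < m.+1)%N by lia.
  rewrite iE in incE *; rewrite subnn eqxx (gtn_eqF (ltnSn m)) !addn0 -incE.
  by apply: eq_bigr => u _; rewrite /= cats0 addn0.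
rewrite subSn //= ltn_eqF // add0n.
rewrite (eq_big_seq (fun u => (if i == m then (sorted ltn u : nat) else 0) +
    (if i == 0 then inc m.+1 R else 0))%N) => [|u uS].
  rewrite big_split /=; congr addn.
    by case: (i == m); [exact: incE | rewrite big1].
  by case: i im im' uL {incE} => [|i] *; rewrite ?subs0 ?big_seq1 // big1.
have [su sL] := uL u uS; rewrite count_cat; congr addn.
  rewrite count_map; case: eqP => [->|mi].
    rewrite subnn subs0 /= addn0; congr nat_of_bool.
    apply/idP/idP => [|hu].
      by move/(subseq_sorted ltn_trans (prefix_subseq _ _)).
    by apply: sorted_cat_lt => // x y /sL/Ln xn; rewrite inE => /eqP ->.
  rewrite (eq_in_count (a2 := pred0)) ?count_pred0 // => v.
  rewrite mem_subs; case: v => [|y v] /=; first lia.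
  case/andP => _ /mem_subseq/(_ y); rewrite mem_head => /(_ isT) /Rn yn.
  apply/negP => /(sorted_pair (a := n) (b := y)); rewrite -cat_rcons.
  by rewrite subseq_pair_cat ?mem_rcons ?mem_head // => /(_ isT); lia.
case: u su sL {uS uL} => [|x u] /= su sL.
  by rewrite -su /= subn0.
rewrite -[i in RHS]su /=.
rewrite (eq_in_count (a2 := pred0)) ?count_pred0 // => v.
rewrite mem_subs; case: v => [|y v] /=; first lia.
case/andP => _ /mem_subseq/(_ y); rewrite mem_head => /(_ isT) yR.
apply/negP; have := @sorted_pair x y (x :: u ++ y :: v).
rewrite -cat_cons subseq_pair_cat ?mem_head // => /(_ isT) h /h.
by have := RL (sL x (mem_head _ _)) yR; lia.
Qed.

(** Only the last letter of the pattern is below the others, so an occurrence crossing into R has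
    exactly its last letter there, and any letter of R will do. The increasing word before it lies
    in L or ends with n. *)
Lemma occ_join k :
  occ k.+2 (L ++ n :: R) =
  (occ k.+2 L + occ k.+2 R + size R * (inc k.+1 L + inc k L))%N.
Proof.
rewrite [LHS]/occ count_subs_cat.
pose G (i : nat) : nat :=
  ((if i == k.+2 then occ i L else 0) + (if i == 0 then occ k.+2 R else 0)
     + ((if i == k.+1 then size R * inc i L else 0) +
        (if i == k then size R * inc i L else 0)))%N.
rewrite (eq_bigr (fun i : 'I_k.+3 => G i)) => [|[i /= ik] _].
  rewrite !big_split /= mulnDr; congr (_ + _ + (_ + _))%N.
  - exact: (sum_ord_eq (occ^~ L)).
  - exact: (sum_ord_eq (fun=> occ k.+2 R)).
  - exact: (sum_ord_eq (fun i => size R * inc i L)%N).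
  - by apply: (sum_ord_eq (fun i => size R * inc i L)%N); lia.
have incE : \sum_(u <- subs i L) (size R * (sorted ltn u : nat))%N = (size R * inc i L)%N.
  by rewrite -big_distrr /= sum_nat_bool.
have uL u : u \in subs i L -> size u = i /\ {subset u <= L}.
  by rewrite mem_subs => /andP[/eqP ? /mem_subseq].
have yR v j : v \in subs j R -> size v = j /\ {subset v <= R}.
  by rewrite mem_subs => /andP[/eqP ? /mem_subseq].
have yuE y u : {subset u <= L} -> y \in R -> sorted ltn (y :: u) = sorted ltn u.
  move=> uL' yR' /=; rewrite (path_sortedE ltn_trans); case: allP => //= -[] x /uL' xL.
  exact: RL.
rewrite /G; have [iE|ik'] : i = k.+2 \/ (i < k.+2)%N by lia.
  rewrite iE; rewrite subnn eqxx (gtn_eqF (ltnSn _)).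
  rewrite (gtn_eqF (ltnW (ltnSn k.+1))) !addn0 /occ -sum_nat_bool.
  by apply: eq_bigr => u _; rewrite /= cats0 addn0.
rewrite subSn //= [i == k.+2]ltn_eqF // add0n.
case: (eqVneq i k.+1) => [ik1|ik1].
  rewrite ik1 subnn (gtn_eqF (ltnSn k)) subs0 /= addn0 -ik1 -incE.
  apply: eq_big_seq => u /uL[su sL].
  rewrite cats1 rotr1_rcons /=.
  (* With n as its last letter, the rotated word would start with its maximum. *)
  have -> : path ltn n u = false.
    case: u su sL => [|x u] /=; first lia.
    by move=> _ /(_ x (mem_head _ _))/Ln; case: ltngtP.
  rewrite add0n (eq_in_count (a2 := fun=> sorted ltn u)) => [|v /yR[]].
    by case: sorted; rewrite ?count_predT ?count_pred0 ?size_subs ?bin1 ?muln1 ?muln0.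
  case: v => [|y [|z v]] //= _ sR.
  by rewrite cats1 rotr1_rcons; apply: yuE => //; apply: sR; rewrite mem_head.
rewrite add0n.
rewrite (eq_big_seq (fun u => (if i == 0 then occ k.+2 R else 0) +
   (if i == k then size R * sorted ltn u else 0))%N) => [|u uS].
  rewrite big_split /=; congr addn; last by case: (i == k); [exact: incE | rewrite big1].
  by case: i ik ik' ik1 uL {incE} => [|i] *; rewrite ?subs0 ?big_seq1 // big1.
have [su sL] := uL u uS; rewrite count_cat addnC; congr addn.
  case: u su sL {uS uL incE} => [|x u] /= su sL.
    by rewrite -su /= subn0.
  rewrite -[i in RHS]su /=.
  rewrite (eq_in_count (a2 := pred0)) ?count_pred0 // => v /yR[].
  case: v => [|y v]; first by move=> /=; lia.
  case/lastP: v => [|v z] sv sR; first by move: sv => /=; lia.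
  rewrite -rcons_cons -rcons_cat -rcons_cons rotr1_rcons.
  apply/negP; have := @sorted_pair x y (z :: (x :: u) ++ y :: v).
  rewrite -[z :: _]cat1s (subseq_trans _ (suffix_subseq _ _)) ?subseq_pair_cat
    ?mem_head // => /(_ isT) h /h.
  by have := RL (sL x (mem_head _ _)) (sR y (mem_head _ _)); lia.
rewrite count_map; case: eqP => [ki|ki].
  rewrite ki subSn // subnn.
  rewrite (eq_in_count (a2 := fun=> sorted ltn u)) => [|v /yR[]].
    by case: sorted; rewrite ?count_predT ?count_pred0 ?size_subs ?bin1 ?muln1 ?muln0.
  case: v => [|y [|z v]] //= _ sR.
  rewrite -cat_rcons cats1 rotr1_rcons; have yR' := sR y (mem_head _ _).
  apply/idP/idP => /=.
    move/path_sorted; rewrite -cats1; exact: (subseq_sorted ltn_trans (prefix_subseq _ _)).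
  rewrite (path_sortedE ltn_trans) => hu.
  apply/andP; split.
    by rewrite all_rcons Rn //=; apply/allP => x /sL xL; apply: RL.
  rewrite -cats1; apply: sorted_cat_lt => // x z /sL/Ln xn.
  by rewrite inE => /eqP ->.
rewrite (eq_in_count (a2 := pred0)) ?count_pred0 // => v /yR[].
case: v => [|y v] /=; first lia.
case/lastP: v => [|v z] sv sR; first by move: sv => /=; lia.
rewrite -!rcons_cons -rcons_cat rotr1_rcons.
apply/negP => /(sorted_pair (a := n) (b := y)).
rewrite -[z :: _]cat1s -[u ++ _]cat_rcons catA subseq_pair_cat ?mem_head
  ?mem_cat ?mem_rcons ?mem_head ?orbT // => /(_ isT).
by have := Rn (sR y (mem_head _ _)); lia.
Qed.

End Join.

(** * Decomposition of 132-avoiding words *)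

Definition is132 (w : seq nat) : bool :=
  if w is [:: a; c; b] then (a < b)%N && (b < c)%N else false.

Definition occ132 (s : seq nat) : nat := count is132 (subs 3 s).

Lemma occ132_map_addn c s : occ132 (map (addn c) s) = occ132 s.
Proof.
rewrite /occ132 subs_map count_map; apply: eq_count => -[|x [|y [|z [|t u]]]] //=.
by rewrite !ltn_add2l.
Qed.

Lemma subseq_pair_cons (a b x : nat) (s : seq nat) :
  subseq [:: a; b] (x :: s) -> b \in s.
Proof.
rewrite /=; case: eqP => _ /mem_subseq/(_ b); rewrite !inE eqxx ?orbT => h; exact: h.
Qed.

(** A 132 word starting with n has nothing above its first letter; one starting in L and ending in
    [n :: R] ends either with the maximum n or below its first letter. *)
Lemma occ132_join (L R : seq nat) (n : nat) :
  {in L, forall x, x < n}%N -> {in L & R, forall x y, y < x}%N ->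
  {in R, forall y, y < n}%N -> occ132 (L ++ n :: R) = (occ132 L + occ132 R)%N.
Proof.
move=> Ln RL Rn; rewrite /occ132 count_subs_cat !big_ord_recl big_ord0 /bump /=.
rewrite subs0 big_seq1 subn0 !subSS !subn0.
rewrite /= count_cat count_map.
rewrite [X in (X + _ + _)%N](eq_in_count (a2 := pred0)) ?count_pred0 => [|v]; last first.
  rewrite mem_subs; case: v => [|c [|b [|? ?]]] //= /mem_subseq/(_ b).
  by rewrite !inE eqxx orbT => /(_ isT)/Rn; lia.
rewrite add0n addnC; congr addn.
rewrite [X in (X + _)%N]big_seq big1 => [|u]; last first.
  rewrite mem_subs; case: u => [|a [|? ?]] //= /mem_subseq/(_ a (mem_head _ _)) aL.
  rewrite -/(subs 2 (n :: R)) (eq_in_count (a2 := pred0)) ?count_pred0 // => v.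
  rewrite mem_subs; case: v => [|c [|b [|? ?]]] //= /subseq_pair_cons bR.
  by have := RL _ _ aL bR; lia.
rewrite add0n [X in (X + _)%N]big_seq big1 => [|u]; last first.
  rewrite mem_subs; case: u => [|a [|c [|? ?]]] //= /mem_subseq uL.
  have aL := uL a (mem_head _ _).
  have cL : c \in L by apply: uL; rewrite !inE eqxx orbT.
  rewrite -/(subs 1 (n :: R)) (eq_in_count (a2 := pred0)) ?count_pred0 // => v.
  rewrite mem_subs; case: v => [|b [|? ?]] // /andP[_].
  rewrite sub1seq inE => /predU1P[->|bR]; first by have := Ln _ cL; rewrite /=; lia.
  by have := RL _ _ aL bR; rewrite /=; lia.
rewrite add0n addn0 -sum_nat_bool; apply: eq_bigr => u _.
by rewrite /= cats0 addn0.
Qed.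

Definition av (n : nat) : seq (seq nat) :=
  [seq s <- permutations (iota 0 n) | occ132 s == 0].

Lemma av_uniq n : uniq (av n).
Proof. exact/filter_uniq/permutations_uniq. Qed.

Lemma mem_av n s : (s \in av n) = (occ132 s == 0) && perm_eq s (iota 0 n).
Proof. by rewrite mem_filter mem_permutations. Qed.

Lemma av0 : av 0 = [:: [::]].
Proof. by []. Qed.

Lemma size_av n s : s \in av n -> size s = n.
Proof. by rewrite mem_av => /andP[_ /perm_size ->]; rewrite size_iota. Qed.

Lemma av_lt n s : s \in av n -> {in s, forall x, x < n}%N.
Proof.
by rewrite mem_av => /andP[_ /perm_mem h] x; rewrite h mem_iota add0n.
Qed.

Definition join (l r : seq nat) : seq nat :=
  map (addn (size r)) l ++ (size l + size r)%N :: r.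

Section JoinAv.

Variables (i j : nat) (l r : seq nat).
Hypotheses (li : l \in av i) (rj : r \in av j).

Lemma join_hyps :
  [/\ {in map (addn (size r)) l, forall x, x < size l + size r}%N,
      {in map (addn (size r)) l & r, forall x y, y < x}%N &
      {in r, forall y, y < size l + size r}%N].
Proof.
have := av_lt li; have := av_lt rj; rewrite (size_av li) (size_av rj) => hr hl.
split.
- by move=> _ /mapP[x /hl xl ->]; lia.
- by move=> _ y /mapP[x /hl xl ->] /hr; lia.
- by move=> y /hr; lia.
Qed.

Lemma inc_joinE m :
  inc m.+1 (join l r) = (inc m.+1 l + inc m l + inc m.+1 r)%N.
Proof. by have [h1 h2 h3] := join_hyps; rewrite inc_join // !inc_map_addn. Qed.

Lemma occ_joinE k :
  occ k.+2 (join l r) =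
  (occ k.+2 l + occ k.+2 r + size r * (inc k.+1 l + inc k l))%N.
Proof.
by have [h1 h2 h3] := join_hyps; rewrite occ_join // !inc_map_addn !occ_map_addn.
Qed.

Lemma join_av : join l r \in av (i + j).+1.
Proof.
have [h1 h2 h3] := join_hyps.
rewrite mem_av occ132_join // occ132_map_addn.
move: li rj; rewrite !mem_av => /andP[/eqP -> pl] /andP[/eqP -> pr]; rewrite addn0 eqxx andTb.
rewrite /join (size_av li) (size_av rj).
have -> : iota 0 (i + j).+1 = iota 0 j ++ iota j i ++ [:: (i + j)%N].
  by rewrite -addn1 [(i + j)%N]addnC !iotaD -catA add0n.
rewrite perm_catC -cat1s -catA perm_catC -catA perm_cat // perm_cat //.
by rewrite -[j in iota j]addn0 iotaDl perm_map.
Qed.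

(** This makes the decomposition injective: the position of the maximum recovers the size of the
    left factor. *)
Lemma index_join : index (i + j)%N (join l r) = i.
Proof.
rewrite /join index_cat (size_av li) (size_av rj) ifN /= ?eqxx ?addn0 ?size_map ?(size_av li) //.
apply/negP => /mapP[x /(av_lt li)]; lia.
Qed.

End JoinAv.

(** Sorting both parts and concatenating gives a sorted word with the letters of [iota 0 n], hence
    that word itself. *)
Lemma iota_split (L R : seq nat) n :
  {in L & R, forall x y, y < x}%N -> perm_eq (L ++ R) (iota 0 n) ->
  perm_eq R (iota 0 (size R)) /\ perm_eq L (iota (size R) (size L)).
Proof.
move=> RL pLR.
have szn : (size R + size L = n)%N.
  by rewrite addnC -size_cat (perm_size pLR) size_iota.
have tot : total leq by exact: leq_total.
have E : sort leq R ++ sort leq L = iota 0 n.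
  apply: (sorted_eq leq_trans anti_leq).
  - rewrite (sorted_pairwise leq_trans) pairwise_cat -!(sorted_pairwise leq_trans).
    rewrite !sort_sorted // !andbT; apply/allrelP => x y.
    by rewrite !mem_sort => xR yL; apply/ltnW/RL.
  - exact: iota_sorted.
  - by rewrite -(permPr pLR) perm_catC perm_cat // perm_sort.
have := E; rewrite -szn iotaD => /eqP.
rewrite eqseq_cat ?size_sort ?size_iota // => /andP[/eqP sR /eqP sL].
by rewrite -(perm_sort leq R) sR -(perm_sort leq L) sL.
Qed.

Lemma av_split n s : s \in av n.+1 ->
  exists i l r, [/\ (i < n.+1)%N, l \in av i, r \in av (n - i) & s = join l r].
Proof.
rewrite mem_av => /andP[/eqP s0 ps].
have us : uniq s by rewrite (perm_uniq ps) iota_uniq.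
have /splitPr sE : n \in s by rewrite (perm_mem ps) mem_iota /=; lia.
case: sE s0 ps us => L R s0 ps us.
have pLR : perm_eq (L ++ R) (iota 0 n).
  rewrite -(perm_cons n) -[n :: L ++ R]/([:: n] ++ L ++ R) perm_catCA (permPl ps).
  by rewrite -addn1 iotaD perm_catC.
have Rn : {in R, forall y, y < n}%N.
  by move=> y yR; have := perm_mem pLR y; rewrite mem_cat yR orbT mem_iota => /esym/andP[].
have Ln : {in L, forall x, x < n}%N.
  by move=> x xL; have := perm_mem pLR x; rewrite mem_cat xL mem_iota => /esym/andP[].
have RL : {in L & R, forall x y, y < x}%N.
  move=> x y xL yR; rewrite ltnNge; apply/negP => xy.
  have xNy : x != y.
    move: us; rewrite cat_uniq /= => /and3P[_ /norP[_ /hasPn/(_ y yR) yL] _].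
    by apply: contraNneq yL => <-.
  (* A letter x of L below a letter y of R produces the 132 word x n y. *)
  have : (0 < occ132 (L ++ n :: R))%N; last by rewrite s0.
  apply/count_subs_gt0P; exists [:: x; n; y]; split => //=.
    by rewrite -[[:: x; n; y]]cat1s cat_subseq ?sub1seq //= eqxx sub1seq.
  by rewrite Rn // ltn_neqAle xNy xy.
have szn : (size L + size R = n)%N.
  by rewrite -size_cat (perm_size pLR) size_iota.
have [pR pL] := iota_split RL pLR.
rewrite (occ132_join Ln RL Rn) in s0.
have pl : perm_eq [seq (x - size R)%N | x <- L] (iota 0 (size L)).
  rewrite (perm_trans (perm_map _ pL)) // -[in X in map _ X](addn0 (size R)).
  rewrite iotaDl -map_comp (eq_map (g := id)) ?map_id // => x /=; lia.
have LE : L = map (addn (size R)) [seq (x - size R)%N | x <- L].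
  rewrite -map_comp -[LHS]map_id; apply/eq_in_map => x /=.
  by rewrite (perm_mem pL) mem_iota; lia.
exists (size L), [seq (x - size R)%N | x <- L], R; split.
- lia.
- by rewrite mem_av pl andbT -(occ132_map_addn (size R)) -LE; lia.
- by rewrite mem_av -szn addKn pR andbT; lia.
- by rewrite /join -LE size_map szn.
Qed.

Lemma perm_av_succ n :
  perm_eq (av n.+1)
    [seq join p.1 p.2 | i <- iota 0 n.+1,
                        p <- [seq (l, r) | l <- av i, r <- av (n - i)]].
Proof.
apply: uniq_perm; first exact: av_uniq.
  apply: allpairs_uniq_dep => [|i _|]; first exact: iota_uniq.
    by apply: allpairs_uniq; rewrite ?av_uniq // => -[? ?] [? ?].
  move=> p p' hp hp'.
  have X := @allpairsPdep _ _ _ _ _ _ p.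
  case/X: hp => i [_ [hi /allpairsP[[l r] /= [hl hr ->]] ->]] {X}.
  have X := @allpairsPdep _ _ _ _ _ _ p'.
  case/X: hp' => i' [_ [hi' /allpairsP[[l' r'] /= [hl' hr' ->]] ->]] {X} /= E.
  move: hi hi'; rewrite !mem_iota !add0n => hi hi'.
  have ii : i = i'.
    rewrite -(index_join hl hr) E subnKC; last lia.
    by rewrite -{1}(@subnKC i' n) ?(index_join hl' hr') //; lia.
  subst i'; move/eqP: E; rewrite /join eqseq_cat ?size_map ?(size_av hl) ?(size_av hl') //.
  case/andP => /eqP ll /eqP[_ rr]; rewrite -rr in ll *.
  by move/(inj_map (@addnI _)): ll => ->.
move=> s; apply/idP/idP.
  case/av_split => i [l [r [hi hl hr ->]]].
  apply/allpairsPdep; exists i, (l, r); split => //; first by rewrite mem_iota.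
  exact: allpairs_f.
case/allpairsPdep => i [_ [hi /allpairsP[[l r] /= [hl hr ->]] ->]].
move: hi; rewrite mem_iota add0n => hi.
by rewrite -(@subnKC i n) ?(join_av hl hr) //; lia.
Qed.

Lemma sum_av_succ (f : seq nat -> nat) n :
  (\sum_(s <- av n.+1) f s =
   \sum_(i < n.+1) \sum_(l <- av i) \sum_(r <- av (n - i)) f (join l r))%N.
Proof.
rewrite (perm_big _ (perm_av_succ n)) big_allpairs_dep.
rewrite -[iota 0 n.+1]/(index_iota 0 n.+1) big_mkord.
by apply: eq_bigr => i _; rewrite big_allpairs.
Qed.

(** * Permutations as words *)

Definition word (n : nat) (pi : 'S_n) : seq nat :=
  [seq val (pi i) | i <- enum 'I_n].

Lemma word_inj n : injective (@word n).
Proof.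
move=> p q /eq_in_map E; apply/permP => i.
by apply: val_inj; apply: E; rewrite mem_enum.
Qed.

Lemma perm_word n (pi : 'S_n) : perm_eq (word pi) (iota 0 n).
Proof.
rewrite /word -val_enum_ord map_comp; apply: perm_map.
apply: uniq_perm; rewrite ?(map_inj_uniq perm_inj) ?enum_uniq //.
move=> i; rewrite mem_enum; apply/mapP; exists (pi^-1%g i); rewrite ?mem_enum //.
by rewrite permKV.
Qed.

Lemma card_perm_word (Q : pred (seq nat)) n :
  #|[set pi : 'S_n | Q (word pi)]| = count Q (permutations (iota 0 n)).
Proof.
have pE : perm_eq (map (@word n) (enum 'S_n)) (permutations (iota 0 n)).
  have uw : uniq (map (@word n) (enum 'S_n)).
    by rewrite map_inj_uniq ?enum_uniq //; exact: word_inj.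
  apply: uniq_perm => //; first exact: permutations_uniq.
  (* Both lists have n! entries, so inclusion of the duplicate-free one suffices. *)
  have [] // := uniq_min_size uw (s2 := permutations (iota 0 n)).
    by move=> _ /mapP[pi _ ->]; rewrite mem_permutations perm_word.
  by rewrite size_permutations ?iota_uniq // size_iota size_map -cardE card_Sn.
rewrite -(seq.permP pE) count_map cardsE cardE -size_filter; congr size.
by rewrite {1}/enum_mem -enumT; apply: eq_filter.
Qed.

Definition same_order (m : nat) (sigma : 'S_m) (u : seq nat) : bool :=
  [forall a : 'I_m, forall b : 'I_m,
     ((nth 0 u a < nth 0 u b) == (sigma a < sigma b))%N].

(** An increasing index function is determined by its list of values, and these lists are exactly
    the subsequences of size m of [enum 'I_n]. *)
Lemma occurrences_word (m n : nat) (sigma : 'S_m) (pi : 'S_n) :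
  occurrences sigma pi = count (same_order sigma) (subs m (word pi)).
Proof.
rewrite /word subs_map count_map -size_filter /occurrences.
pose h (i : {ffun 'I_m -> 'I_n}) := [seq i a | a <- enum 'I_m].
have h_inj : injective h.
  by move=> i j /eq_in_map E; apply/ffunP => a; apply: E; rewrite mem_enum.
have nth_h i (a : 'I_m) : nth 0%N [seq val (pi x) | x <- h i] a = pi (i a) :> nat.
  rewrite /h -map_comp (nth_map a) ?size_enum_ord // nth_ord_enum //.
have subP (u : seq 'I_n) : subseq u (enum 'I_n) = sorted (fun x y : 'I_n => (x < y)%N) u.
  apply/idP/idP => [/subseq_sorted -> //|su].
  - by move=> y x z; exact: ltn_trans.
  - by have := iota_ltn_sorted 0 n; rewrite -val_enum_ord sorted_map.
  rewrite (_ : u = filter (mem u) (enum 'I_n)) ?filter_subseq //.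
  apply: (@irr_sorted_eq _ (fun x y : 'I_n => (x < y)%N)) => //.
  - by move=> y x z; exact: ltn_trans.
  - by move=> x; rewrite ltnn.
  - apply: sorted_filter; first by move=> y x z; exact: ltn_trans.
    by have := iota_ltn_sorted 0 n; rewrite -val_enum_ord sorted_map.
  - by move=> x; rewrite mem_filter mem_enum andbT.
rewrite cardE -(size_map h); apply/perm_size/uniq_perm.
- by rewrite map_inj_uniq ?enum_uniq.
- by rewrite filter_uniq // subs_uniq // enum_uniq.
move=> u; apply/mapP/idP => [[i]|].
  rewrite mem_enum inE => /andP[/forallP incr /forallP ord] ->.
  rewrite mem_filter mem_subs size_map size_enum_ord eqxx andTb; apply/andP; split.
    apply/forallP => a; apply/forallP => b; rewrite !nth_h.
    by have /forallP := ord a.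
  rewrite subP sorted_map.
  apply: (@sub_sorted _ (fun a b : 'I_m => (a < b)%N)).
    by move=> a b; have /forallP/(_ b)/implyP := incr a.
  by have := iota_ltn_sorted 0 m; rewrite -val_enum_ord sorted_map.
rewrite mem_filter mem_subs => /and3P[/= ord /eqP su us].
pose i : {ffun 'I_m -> 'I_n} := [ffun a => tnth (tcast su (in_tuple u)) a].
have hi : h i = u.
  rewrite /h (eq_map (g := tnth (tcast su (in_tuple u)))) => [|a]; last by rewrite ffunE.
  by rewrite map_tnth_enum val_tcast.
exists i => //; rewrite mem_enum inE; apply/andP; split.
  apply/forallP => a; apply/forallP => b; apply/implyP => ab.
  have nh x0 (c : 'I_m) : nth x0 (h i) c = i c.
    by rewrite (nth_map c) ?size_enum_ord // nth_ord_enum.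
  rewrite -(nh (i a) a) -(nh (i a) b).
  have lt_tr : transitive (fun x y : 'I_n => (x < y)%N) by move=> y x z; exact: ltn_trans.
  apply: (sorted_ltn_nth lt_tr) => //.
  - by rewrite hi -subP.
  - by rewrite inE size_map size_enum_ord.
  - by rewrite inE size_map size_enum_ord.
apply/forallP => a; apply/forallP => b; rewrite -!nth_h hi.
exact: (forallP (forallP ord a) b).
Qed.

Lemma pat132E (a : 'I_3) : pat132 a = nth 0 [:: 0; 2; 1] a :> nat.
Proof.
have i1 : inord 1 = Ordinal (isT : 1 < 3)%N by apply: val_inj; rewrite /= inordK.
have i2 : inord 2 = Ordinal (isT : 2 < 3)%N by apply: val_inj; rewrite /= inordK.
rewrite /pat132 i1 i2.
by case: a => -[|[|[|//]]] ha; rewrite permE /=.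
Qed.

Lemma same_order_pat132 (u : seq nat) :
  size u = 3 -> same_order pat132 u = is132 u.
Proof.
case: u => [|a [|c [|b [|? ?]]]] // _; apply/forallP/idP => /= [h|h].
  have /forallP/(_ (Ordinal (isT : 2 < 3)%N)) := h (Ordinal (isT : 0 < 3)%N).
  have /forallP/(_ (Ordinal (isT : 1 < 3)%N)) := h (Ordinal (isT : 2 < 3)%N).
  by rewrite !pat132E /= => /eqP -> /eqP ->.
move=> x; apply/forallP => y; rewrite !pat132E.
by case: x => -[|[|[|//]]] ?; case: y => -[|[|[|//]]] ? /=; lia.
Qed.

(** The pattern is a cyclic shift, so letter a of u stands at position sigma(a) of [rotr 1 u]; being
    ordered like sigma becomes being ordered like the identity. *)
Lemma same_order_pat23k1 k (u : seq nat) :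
  size u = k.+1 -> same_order (pat23k1 k.+1) u = sorted ltn (rotr 1 u).
Proof.
move=> su; set w := rotr 1 u.
have sw : size w = k.+1 by rewrite size_rotr.
have nth_w (a : 'I_k.+1) : nth 0 u a = nth 0 w (pat23k1 k.+1 a).
  rewrite /pat23k1 permE /w; case/lastP: u su {w sw} => // u z.
  rewrite size_rcons rotr1_rcons /= => -[su]; rewrite nth_rcons su.
  have := ltn_ord a; rewrite ltnS leq_eqVlt => /predU1P[ak|ak].
    by rewrite ak ltnn eqxx modnn.
  by rewrite ak modn_small.
apply/forallP/idP => [h|sw'].
  apply/(sortedP 0) => i; rewrite sw => ik.
  pose p := (pat23k1 k.+1)^-1%g (Ordinal (ltnW ik)).
  pose q := (pat23k1 k.+1)^-1%g (Ordinal ik).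
  have /forallP/(_ q) := h p.
  by rewrite !nth_w !permKV /= ltnSn => /eqP.
move=> a; apply/forallP => b; rewrite !nth_w.
move: (pat23k1 _ a) (pat23k1 _ b) => p q; apply/eqP.
have mono := sorted_ltn_nth ltn_trans 0 sw'.
have [pS qS] : val p \in [pred i | i < size w]%N /\ val q \in [pred i | i < size w]%N.
  by rewrite !inE sw !ltn_ord.
case: (ltngtP p q) => [pq|qp|->]; last by rewrite ltnn.
  exact: (mono _ _ pS qS pq).
by have := mono _ _ qS pS qp => /=; lia.
Qed.

Lemma num_permsE k r n : num_perms k.+1 r n = count (fun s => occ k.+1 s == r) (av n).
Proof.
rewrite /num_perms /av count_filter -card_perm_word; congr #|pred_of_set _|.
apply/setP => pi; rewrite !inE /avoids !occurrences_word /= andbC.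
congr ((_ == r) && (_ == 0%N)).
  by apply: eq_in_count => u; rewrite mem_subs => /andP[/eqP su _]; exact: same_order_pat23k1.
by apply: eq_in_count => u; rewrite mem_subs => /andP[/eqP su _]; exact: same_order_pat132.
Qed.

Local Open Scope ring_scope.

(** * Formal power series *)

(** Equalities of power series are treated below as congruences of truncations modulo X^N, which
    reduces them to polynomial identities. *)
Lemma dvdp_XnP (F : fieldType) (N : nat) (p : {poly F}) :
  reflect (forall m, (m < N)%N -> p`_m = 0) ('X^N %| p).
Proof.
apply: (iffP idP) => [/dvdpP[q ->] m mN|h]; first by rewrite coefMXn mN.
rewrite -(poly_take_drop N p) (_ : take_poly N p = 0) ?add0r ?dvdp_mull //.
by apply/polyP => m; rewrite coef_take_poly coef0; case: ltnP => // /h.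
Qed.

Definition conv (A : pzSemiRingType) (a b : nat -> A) (n : nat) : A :=
  \sum_(i < n.+1) a i * b (n - i)%N.

Definition trunc (A : nzSemiRingType) (a : nat -> A) (N : nat) : {poly A} :=
  \poly_(i < N) a i.

Lemma coef_trunc (A : nzSemiRingType) (a : nat -> A) N m :
  (m < N)%N -> (trunc a N)`_m = a m.
Proof. by move=> mN; rewrite coef_poly mN. Qed.

Lemma coef_trunc_mul (A : nzSemiRingType) (a b : nat -> A) N m :
  (m < N)%N -> (trunc a N * trunc b N)`_m = conv a b m.
Proof.
move=> mN; rewrite coefM; apply: eq_bigr => -[i /= im] _.
by rewrite !coef_trunc //; lia.
Qed.

Lemma coef_trunc_mulp (A : nzSemiRingType) (a : nat -> A) (q : {poly A}) N m :
  (m < N)%N -> (trunc a N * q)`_m = \sum_(i < m.+1) a i * q`_(m - i).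
Proof.
move=> mN; rewrite coefM; apply: eq_bigr => -[i /= im] _.
by rewrite coef_trunc //; lia.
Qed.

Lemma dvdp_trunc_conv (F : fieldType) (a b : nat -> F) N :
  'X^N %| trunc (conv a b) N - trunc a N * trunc b N.
Proof.
apply/dvdp_XnP => m mN.
by rewrite coefB coef_trunc_mul // coef_trunc // subrr.
Qed.

Section Expansion.

Variable R : realType.
Implicit Types (a b c d : nat -> R) (f g h : {fraction {poly R}}).

Lemma is_expansionP b f :
  is_expansion b f <->
  exists p q : {poly R}, [/\ q != 0, f = tofrac p / tofrac q &
    forall N, 'X^N %| trunc b N * q - p].
Proof.
split=> -[p [q [q0 fE h]]]; exists p, q; split=> // m.
  by apply/dvdp_XnP => i im; rewrite coefB coef_trunc_mulp // h subrr.
have /dvdp_XnP/(_ m (ltnSn m)) := h m.+1.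
by rewrite coefB coef_trunc_mulp // => /eqP; rewrite subr_eq0 => /eqP.
Qed.

Lemma eq_expansion b c f : b =1 c -> is_expansion b f -> is_expansion c f.
Proof.
move=> bc [p [q [q0 fE h]]]; exists p, q; split=> // m.
by rewrite -h; apply: eq_bigr => i _; rewrite bc.
Qed.

Lemma expansionD b c f g :
  is_expansion b f -> is_expansion c g ->
  is_expansion (fun n => b n + c n) (f + g).
Proof.
move=> /is_expansionP[p [q [q0 -> hb]]] /is_expansionP[p' [q' [q'0 -> hc]]].
apply/is_expansionP; exists (p * q' + p' * q), (q * q'); split.
- by rewrite mulf_neq0.
- by rewrite addf_div ?tofrac_eq0 // !rmorphD !rmorphM.
move=> N; have -> : trunc (fun n => b n + c n) N = trunc b N + trunc c N.
  apply/polyP => m; rewrite coefD !coef_poly; case: ltnP => //.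
  by rewrite addr0.
have -> : (trunc b N + trunc c N) * (q * q') - (p * q' + p' * q) =
  (trunc b N * q - p) * q' + (trunc c N * q' - p') * q by ring.
by rewrite dvdp_add ?dvdp_mulr.
Qed.

Lemma expansion_conv b c f g :
  is_expansion b f -> is_expansion c g -> is_expansion (conv b c) (f * g).
Proof.
move=> /is_expansionP[p [q [q0 -> hb]]] /is_expansionP[p' [q' [q'0 -> hc]]].
apply/is_expansionP; exists (p * p'), (q * q'); split.
- by rewrite mulf_neq0.
- by rewrite mulf_div !rmorphM.
move=> N; have -> : trunc (conv b c) N * (q * q') - p * p' =
  (trunc (conv b c) N - trunc b N * trunc c N) * (q * q') +
  ((trunc b N * q - p) * (trunc c N * q') + (trunc c N * q' - p') * p) by ring.
by rewrite !dvdp_add ?dvdp_mulr // dvdp_trunc_conv.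
Qed.

(** Rationality of [a] is a conclusion: once the recursion is multiplied by the denominators of f
    and h, the error is a combination of terms divisible by X^N. *)
Lemma expansion_fixpoint a b d f h :
  is_expansion b f -> is_expansion d h -> 1 - f != 0 ->
  (forall n, a n = d n + conv b a n) -> is_expansion a (h / (1 - f)).
Proof.
move=> /is_expansionP[p [q [q0 fE hb]]] /is_expansionP[p' [q' [q'0 -> hd]]] f1 aE.
have tq0 : tofrac q != 0 by rewrite tofrac_eq0.
have E1 : 1 - f = tofrac (q - p) / tofrac q by rewrite fE rmorphB mulrBl divff.
have qp0 : q - p != 0.
  by apply: contraNneq f1; rewrite E1 => ->; rewrite rmorph0 mul0r.
apply/is_expansionP; exists (p' * q), (q * q' - p * q'); split.
- by rewrite -mulrBl mulf_neq0.
- by rewrite E1 -mulrBl !tofracM invf_div mulf_div (mulrC (tofrac q')).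
move=> N; have -> : trunc a N * (q * q' - p * q') - p' * q =
  (trunc (conv b a) N - trunc b N * trunc a N) * (q * q') +
  (trunc a N - trunc d N - trunc (conv b a) N) * (q * q') +
  (trunc d N * q' - p') * q + (trunc b N * q - p) * (trunc a N * q') by ring.
have -> : trunc a N - trunc d N - trunc (conv b a) N = 0.
  apply/polyP => m; rewrite !coefB !coef_poly coef0; case: ltnP => _.
    by rewrite aE; ring.
  by rewrite !subr0.
by rewrite mul0r addr0 !dvdp_add ?dvdp_mulr // dvdp_trunc_conv.
Qed.

Definition in_sqrtx a (m : nat) : R := if odd m then 0 else a m./2.

Lemma in_sqrtx_conv a b :
  in_sqrtx (conv a b) =1 conv (in_sqrtx a) (in_sqrtx b).
Proof.
move=> m; pose N := m.+1.
(* Passing from x to s is the substitution x = s^2, which respects products. *)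
have truncE c : trunc (in_sqrtx c) (N * 2) = trunc c N \Po 'X^2.
  apply/polyP => i; rewrite coef_comp_poly_Xn // !coef_poly /in_sqrtx dvdn2.
  rewrite divn2; case: (boolP (odd i)) => /= oi; first by rewrite if_same.
  have -> : (i < N * 2)%N = (i./2 < N)%N by lia.
  by [].
rewrite -(@coef_trunc_mul _ _ _ (N * 2)%N); last lia.
rewrite !truncE -comp_polyM coef_comp_poly_Xn // dvdn2 /in_sqrtx divn2.
by case: odd => //=; rewrite coef_trunc_mul //; lia.
Qed.

(** This is [is_generating_function] for real-valued sequences, a class closed under the linear
    combinations and convolutions used below. *)
Definition gf a f : Prop := is_expansion (in_sqrtx a) f.

Lemma eq_gf a b f : a =1 b -> gf a f -> gf b f.
Proof. by move=> ab; apply: eq_expansion => m; rewrite /in_sqrtx ab. Qed.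

Lemma gfD a b f g : gf a f -> gf b g -> gf (fun n => a n + b n) (f + g).
Proof.
move=> af bg; apply: eq_expansion (expansionD af bg) => m.
by rewrite /in_sqrtx; case: odd; rewrite ?addr0.
Qed.

Lemma gf_conv a b f g : gf a f -> gf b g -> gf (conv a b) (f * g).
Proof.
move=> af bg; apply: eq_expansion (expansion_conv af bg) => m.
by rewrite in_sqrtx_conv.
Qed.

Definition monomial (l : nat) (c : R) (n : nat) : R := if n == l then c else 0.

Lemma gf_monomial l (c : R) : gf (monomial l c) (tofrac c%:P * sqrtx R ^+ 2 ^+ l).
Proof.
apply/is_expansionP; exists (c%:P * 'X^2 ^+ l), 1; split.
- exact: oner_neq0.
- by rewrite rmorph1 divr1 rmorphM !rmorphXn.
move=> N; rewrite mulr1; apply/dvdp_XnP => m mN.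
rewrite -exprM coefB coef_trunc // coefCM coefXn /in_sqrtx /monomial.
case: (boolP (odd m)) => om.
  by rewrite (_ : m == _ = false) ?mulr0 ?subr0 //; lia.
rewrite (_ : (m == (2 * l)%N) = (m./2 == l)); last lia.
by case: eqP => _; rewrite ?mulr1 ?mulr0 subrr.
Qed.

Lemma gf0 : gf (fun=> 0) 0.
Proof.
have := gf_monomial 0 0; rewrite rmorph0 mul0r; apply: eq_gf => n.
by rewrite /monomial if_same.
Qed.

Lemma gf_sum (I : eqType) (r : seq I) (F : I -> nat -> R) (f : I -> {fraction {poly R}}) :
  {in r, forall i, gf (F i) (f i)} ->
  gf (fun n => \sum_(i <- r) F i n) (\sum_(i <- r) f i).
Proof.
elim: r => [_|i r IH h].
  by rewrite big_nil; apply: eq_gf gf0 => n; rewrite big_nil.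
rewrite big_cons; apply: eq_gf (gfD (h _ (mem_head _ _)) (IH _)) => [n|j jr].
  by rewrite big_cons.
by apply: h; rewrite inE jr orbT.
Qed.

Definition shift a (n : nat) : R := if n is n'.+1 then a n' else 0.

Lemma conv_monomial l (c : R) a n :
  conv (monomial l c) a n = if (l <= n)%N then c * a (n - l)%N else 0.
Proof.
rewrite /conv /monomial; case: leqP => ln.
  rewrite (bigD1 (Ordinal (ln : (l < n.+1)%N))) //= eqxx big1 ?addr0 // => i il.
  by rewrite ifN ?mul0r //; apply: contraNneq il => il; apply/eqP/val_inj.
by rewrite big1 // => -[i /= ni] _; rewrite ifN ?mul0r //; lia.
Qed.

Lemma gf_shift a f : gf a f -> gf (shift a) (sqrtx R ^+ 2 * f).
Proof.
move=> /(gf_conv (gf_monomial 1 1)); rewrite rmorph1 mul1r expr1.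
by apply: eq_gf => -[|n]; rewrite conv_monomial //= mul1r subn1.
Qed.

Lemma conv_shift a b n : conv (shift a) b n.+1 = conv a b n.
Proof. by rewrite /conv big_ord_recl mul0r add0r. Qed.

Lemma gf_fixpoint a b d f h :
  gf b f -> gf d h -> 1 - sqrtx R ^+ 2 * f != 0 -> a 0%N = d 0%N ->
  (forall n, a n.+1 = d n.+1 + conv b a n) -> gf a (h / (1 - sqrtx R ^+ 2 * f)).
Proof.
move=> /gf_shift bf dh f1 a0 aS; apply: expansion_fixpoint bf dh f1 _ => m.
rewrite -in_sqrtx_conv /in_sqrtx; case: odd; first by rewrite addr0.
case: m./2 => [|n]; last by rewrite conv_shift.
by rewrite a0 /conv big_ord1 mul0r addr0.
Qed.

End Expansion.

(* Differentiating c = 1 + x c^2 and eliminating c^2 gives the linear           *)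
(* differential equation x (1 - 4 x) c' + (1 - 2 x) c = 1, that is, the          *)
(* two-term recurrence (n + 2) c_(n+1) = (4 n + 2) c_n.                          *)
Lemma catalan_rec (c : nat -> nat) :
  c 0%N = 1%N -> (forall n, c n.+1 = \sum_(i < n.+1) c i * c (n - i))%N ->
  forall n, (n.+2 * c n.+1 = (4 * n + 2) * c n)%N.
Proof.
move=> c0 cS n; pose a i : rat := (c i)%:R; pose N := n.+2; pose p := trunc a N.
have aE i : a i.+1 = conv a a i.
  by rewrite /a cS natr_sum; apply: eq_bigr => j _; rewrite natrM.
pose E := p - 1 - 'X * p ^+ 2.
have dvdE : 'X^N %| E.
  apply/dvdp_XnP => -[|m] mN; rewrite !coefB coef1 coefXM.
    by rewrite coef_trunc // /a c0 !subrr.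
  by rewrite /= subr0 coef_trunc // expr2 coef_trunc_mul ?aE ?subrr //; lia.
(* Differentiation loses one order of divisibility; the factor X restores it. *)
have dvdE' : 'X^N %| 'X * E^`().
  apply/dvdp_XnP => -[|m] mN; rewrite coefXM //= coef_deriv.
  by have /dvdp_XnP -> // := dvdE; rewrite mul0rn.
have : 'X^N %| 'X * p^`() - 'X * ('X * p^`()) *+ 4 + p - ('X * p) *+ 2 - 1.
  have dE : E^`() = p^`() - p ^+ 2 - 'X * (p * p^`() *+ 2).
    rewrite /E !derivB derivM derivX derivC subr0 mul1r expr2.
    by rewrite derivM mulr2n (mulrC p^`()) opprD addrA.
  (* The multiplier 1 - 2 X p is the derivative of E in p; modulo E its square is the discriminant 1
     - 4 X. *)
  have -> : 'X * p^`() - 'X * ('X * p^`()) *+ 4 + p - ('X * p) *+ 2 - 1 =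
    ('X * E^`()) * (1 - 2%:R * 'X * p) +
    E * (4%:R * 'X ^+ 2 * p^`() + 2%:R - (1 - 2%:R * 'X * p)).
    by rewrite dE /E; ring.
  by apply: dvdp_add; apply: dvdp_mulr.
move/dvdp_XnP/(_ n.+1 (ltnSn _)).
rewrite !(coefB, coefD, coefMn, coefXM, coef1) /= subr0.
have -> : (if n == 0 then 0 else p^`()`_n.-1) = a n *+ n.
  by case: n @N @p {E dvdE dvdE'} => [|n] N p //=; rewrite coef_deriv coef_trunc.
rewrite coef_deriv !coef_trunc //.
move=> h; apply/eqP; rewrite -(eqr_nat rat) -subr_eq0 -[X in _ == X]h; apply/eqP.
by rewrite !natrM -/(a n) -/(a n.+1); ring.
Qed.

Lemma catalan_bin (c : nat -> nat) :
  c 0%N = 1%N -> (forall n, c n.+1 = \sum_(i < n.+1) c i * c (n - i))%N ->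
  forall n, (n.+1 * c n = 'C(2 * n, n))%N.
Proof.
move=> c0 cS; elim=> [|n IH]; first by rewrite c0.
have := catalan_rec c0 cS n.
have := mul_bin_diag (2 * n).+2 n; have := mul_bin_diag (2 * n).+1 n.
(* The symmetry C(2n+1, n) = C(2n+1, n+1) chains the two absorption identities from C(2n, n) to
   C(2n+2, n+1). *)
rewrite -[in X in _ -> X -> _](bin_sub (m := n)); last lia.
have -> : ((2 * n).+2.-1 - n = n.+1)%N by lia.
rewrite /= (_ : (2 * n.+1 = (2 * n).+2)%N); last lia.
rewrite -{}IH => h1 h2 h3.
apply/eqP; rewrite -(eqn_pmul2l (ltn0Sn n)); apply/eqP.
rewrite -h2; nia.
Qed.

(** * Recurrences *)

Definition num_av (n : nat) : nat := size (av n).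

Definition num_inc (m j n : nat) : nat :=
  count (fun s => (inc m s == j) && (inc m.+1 s == 0)) (av n).

Definition num_occ (k r n : nat) : nat := count (fun s => occ k s == r) (av n).

Lemma sum_av_pair (P Q : pred (seq nat)) i j :
  (\sum_(l <- av i) \sum_(r <- av j) P l * Q r = count P (av i) * count Q (av j))%N.
Proof. by rewrite -!sum_nat_bool big_distrlr. Qed.

Lemma num_av_succ n :
  num_av n.+1 = (\sum_(i < n.+1) num_av i * num_av (n - i))%N.
Proof.
rewrite /num_av -sum1_size sum_av_succ; apply: eq_bigr => i _.
by rewrite -!sum1_size big_distrlr.
Qed.

Lemma num_av_bin n : (n.+1 * num_av n = 'C(2 * n, n))%N.
Proof. exact: (catalan_bin (erefl : num_av 0 = 1%N) num_av_succ). Qed.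

Lemma num_inc0 j n : num_inc 0 j n = ((j == 1) && (n == 0))%N.
Proof.
rewrite /num_inc (eq_in_count (a2 := fun=> (j == 1) && (n == 0))%N) => [|s sn].
  case: andP => [[_ /eqP ->] //|_]; exact: count_pred0.
by rewrite inc0 inc1 (size_av sn) eq_sym.
Qed.

Lemma num_inc_succ0 m j : num_inc m.+1 j 0 = (j == 0)%N.
Proof. by rewrite /num_inc av0 /= andbT addn0 eq_sym. Qed.

(** If the joined word has no increasing word of length m+2, its left factor has none of length m+1;
    the summation index a is then the number of those of length m in the left factor. *)
Lemma num_inc_succ m j n :
  num_inc m.+1 j n.+1 =
  (\sum_(a < j.+1) \sum_(i < n.+1) num_inc m a i * num_inc m.+1 (j - a) (n - i))%N.
Proof.
rewrite /num_inc -sum_nat_bool sum_av_succ [RHS]exchange_big /=.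
apply: eq_bigr => i _.
under [RHS]eq_bigr do rewrite -sum_av_pair.
rewrite [RHS]exchange_big /= [LHS]big_seq [RHS]big_seq; apply: eq_bigr => l hl.
rewrite [RHS]exchange_big /= [LHS]big_seq [RHS]big_seq; apply: eq_bigr => r hr.
rewrite !(inc_joinE hl hr).
case: (eqVneq (inc m.+1 l) 0%N) => [l0|l0]; last first.
  by rewrite big1 ?andbF // => [|a _]; rewrite ?andbF //; lia.
rewrite (inc_succ_eq0 l0) l0 !add0n.
under eq_bigr do rewrite andbT.
case: (leqP (inc m l) j) => lj; last first.
  rewrite big1 => [|a _]; last by rewrite gtn_eqF //; have := ltn_ord a; lia.
  by rewrite (gtn_eqF (leq_trans lj (leq_addr _ _))).
rewrite (bigD1 (Ordinal (lj : (inc m l < j.+1)%N))) //= eqxx mul1n.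
rewrite big1 => [|a /eqP al].
  by rewrite addn0; congr (nat_of_bool (_ && _)); lia.
by case: eqP => // la; case: al; apply: val_inj.
Qed.

Lemma num_occ0 k r : (0 < r)%N -> num_occ k.+1 r 0 = 0%N.
Proof. by case: r => // r _; rewrite /num_occ av0. Qed.

(* Here a, b are the numbers of increasing words of lengths k, k+1 in the left *)
(* factor, o and o' the numbers of occurrences of the pattern in the left and  *)
(* right factors, and l is the size of the right factor. An increasing word of *)
(* length k+1 contains k+1 increasing words of length k, so b > 0 and l > 0    *)
(* would already produce more than k+1 occurrences.                            *)
Lemma occ_join_cases k r a b o o' l :
  (1 <= r <= k.+1)%N -> ((0 < b) -> (k.+1 <= a))%N -> ((0 < o) -> (0 < b))%N ->
  ((l < k.+2) -> o' = 0)%N ->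
  ((o + o' + l * (b + a) == r) =
   ((l == 0) && (o == r)) + ((a == 0) && (o' == r)) +
   ((0 < l) && ((a == r %/ l) && (b == 0) && (l %| r))) :> nat)%N.
Proof.
move=> hr ba ob lo'.
have -> : ((0 < l) && ((a == r %/ l) && (b == 0) && (l %| r)) =
           (0 < l) && ((a * l == r) && (b == 0)))%N.
  case: l {lo'} => [|l] //=; rewrite andbAC; congr (_ && _).
  apply/idP/idP => [/andP[/eqP -> /divnK ->] //|/eqP <-].
  by rewrite mulnK // eqxx dvdn_mull.
case: l lo' => [|l] lo'.
  rewrite lo' // mul0n !addn0 /=.
  by case: eqP => // a0; case: eqP => //; lia.
rewrite /= add0n.
case: (posnP a) => [a0|a0].
  have b0 : b = 0%N by lia.
  have o0 : o = 0%N by lia.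
  by rewrite a0 b0 o0 /= muln0 mul0n; case: r hr {lo'} => // r _; rewrite !addn0 add0n.
case: (posnP b) => [b0|b0].
  have o0 : o = 0%N by lia.
  rewrite b0 o0 andbT !add0n mulnC; congr nat_of_bool.
  case: (ltnP l.+1 k.+2) => [/lo' -> //|kl].
  by apply/idP/idP => /eqP; nia.
by rewrite andbF addn0; apply/eqP; rewrite eqb0; apply/eqP; nia.
Qed.

(** The three summands are the three mutually exclusive alternatives of [occ_join_cases], summed
    over all pairs of factors. *)
Lemma num_occ_succ k r n : (1 <= r <= k.+1)%N ->
  num_occ k.+2 r n.+1 =
  (num_occ k.+2 r n +
   \sum_(i < n.+1) num_inc k 0 i * num_occ k.+2 r (n - i) +
   \sum_(l <- divisors r) \sum_(i < n.+1)
     num_inc k (r %/ l) i * (if n - i == l then num_av l else 0))%N.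
Proof.
move=> hr; rewrite /num_occ -sum_nat_bool sum_av_succ.
(* An empty right factor leaves only i = n. *)
have -> : count (fun s => occ k.+2 s == r) (av n) =
    (\sum_(i < n.+1) \sum_(u <- av i) \sum_(v <- av (n - i))
      ((n - i == 0) && (occ k.+2 u == r)))%N.
  rewrite big_ord_recr /= subnn av0 big1 ?add0n => [|i _].
    by rewrite -sum_nat_bool; apply: eq_bigr => u _; rewrite big_seq1.
  by rewrite big1 // => u _; rewrite big1 // => v _; have := ltn_ord i; lia.
have -> : (\sum_(l <- divisors r) \sum_(i < n.+1)
     num_inc k (r %/ l) i * (if n - i == l then num_av l else 0) =
   \sum_(i < n.+1) \sum_(u <- av i) \sum_(v <- av (n - i))
     ((0 < n - i) && ((inc k u == r %/ (n - i)) && (inc k.+1 u == 0) && (n - i %| r))))%N.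
  rewrite exchange_big /=; apply: eq_bigr => i _.
  transitivity (if (0 < n - i) && (n - i %| r) then
     num_inc k (r %/ (n - i)) i * num_av (n - i) else 0)%N.
    have -> : ((0 < n - i) && (n - i %| r) = (n - i \in divisors r))%N.
      rewrite -dvdn_divisors; last lia.
      by case: (n - i)%N => //=; rewrite dvd0n; lia.
    case: (boolP (_ \in _)) => hd.
      rewrite (bigD1_seq _ hd) ?divisors_uniq //= eqxx big1 ?addn0 // => l lE.
      by rewrite eq_sym (negPf lE) muln0.
    rewrite big_seq big1 // => l hl; case: eqP => [lE|]; last by rewrite muln0.
    by rewrite lE hl in hd.
  case: (0 < n - i)%N => /=; last by rewrite big1 // => u _; rewrite big1.
  case: (n - i %| r)%N => /=; last first.
    by rewrite big1 // => u _; rewrite big1 // => v _; rewrite andbF.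
  rewrite /num_inc /num_av -count_predT -sum_av_pair.
  by apply: eq_bigr => u _; apply: eq_bigr => v _; rewrite muln1 andbT.
rewrite -!big_split /=; apply: eq_bigr => i _.
have -> : (num_inc k 0 i * count (fun s => occ k.+2 s == r) (av (n - i)) =
    \sum_(u <- av i) \sum_(v <- av (n - i)) ((inc k u == 0) && (occ k.+2 v == r)))%N.
  rewrite /num_inc -sum_av_pair.
  apply: eq_bigr => u _; apply: eq_bigr => v _; rewrite mulnb.
  by case: eqP => //= /inc_succ_eq0 ->.
rewrite -!big_split /= big_seq [RHS]big_seq; apply: eq_bigr => u hu.
rewrite -!big_split /= big_seq [RHS]big_seq; apply: eq_bigr => v hv.
rewrite (occ_joinE hu hv) -(size_av hv).
apply: (occ_join_cases hr).
- exact: inc_lower.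
- exact: occ_inc.
- exact: occ_size_lt.
Qed.

(** * Solution of the recurrences through Chebyshev identities *)

Section ClosedForm.

Variables (F : fieldType) (s : F) (W : nat -> F).
Hypotheses (s0 : s != 0) (W0 : W 0 = 0) (W1 : W 1 = 1).
Hypothesis Wrec : forall m, W m.+2 = W m.+1 / s - W m.
Hypothesis Wneq0 : forall m, W m.+1 != 0.

(** The recurrence leaves the left side unchanged when m grows by one. *)
Lemma chebyshev_cassini m : W m.+1 ^+ 2 - W m.+2 * W m = 1.
Proof.
elim: m => [|m IH]; first by rewrite W0 W1 mulr0 subr0 expr1n.
rewrite -IH (Wrec m.+1) [W m.+2]Wrec; ring.
Qed.

(** For m >= 1 this is the coefficient of y^j in (W_m - s y W_(m-1)) / (s (W_(m+1) - s y W_m)),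
    expanded as a geometric series with the help of Cassini's identity. *)
Definition inc_closed (m j : nat) : F :=
  if j is j'.+1 then (s * W m / W m.+1) ^+ j' / W m.+1 ^+ 2
  else W m / (s * W m.+1).

Lemma one_sub_inc_closed m :
  1 - s ^+ 2 * inc_closed m 0 = s * W m.+2 / W m.+1.
Proof.
rewrite /inc_closed Wrec; field.
by rewrite Wneq0 s0.
Qed.

Lemma one_sub_inc_closed1 m :
  1 - s ^+ 2 * (1 + inc_closed m 0) = s ^+ 2 * W m.+3 / W m.+1.
Proof.
rewrite /inc_closed (Wrec m.+1) [W m.+2]Wrec; field.
by rewrite Wneq0 s0.
Qed.

(** Apart from its last term this convolves two geometric sequences. Peeling off the first summand
    gives an induction on j, closed by replacing a numerator 1 with Cassini's identity. *)
Lemma inc_closed_conv m j :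
  \sum_(i < j.+1) inc_closed m i.+1 * inc_closed m.+1 (j - i) =
  W m.+2 / (s * W m.+1) * inc_closed m.+1 j.+1.
Proof.
elim: j => [|j IH].
  rewrite big_ord1 /= !expr0; field.
  by rewrite !Wneq0 s0.
have geom i : inc_closed m i.+2 = s * W m / W m.+1 * inc_closed m i.+1.
  by rewrite /= exprS -mulrA.
rewrite big_ord_recl subn0.
under eq_bigr => i _ do rewrite lift0 subSS geom -mulrA.
rewrite -big_distrr /= IH /= expr0 (exprS _ j).
rewrite -[X in X / _ * _ + _](chebyshev_cassini m); set x := _ ^+ j; field.
by rewrite !Wneq0 s0.
Qed.

Lemma one_sub_inc_closed_neq0 m : 1 - s ^+ 2 * inc_closed m 0 != 0.
Proof. by rewrite one_sub_inc_closed !mulf_neq0 ?invr_neq0. Qed.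

Lemma one_sub_inc_closed1_neq0 m : 1 - s ^+ 2 * (1 + inc_closed m 0) != 0.
Proof. by rewrite one_sub_inc_closed1 !mulf_neq0 ?invr_neq0 ?expf_neq0. Qed.

Lemma fixpoint_cancel (w w' g : F) :
  w != 0 -> w' != 0 -> g = s ^+ 2 * (w' / (s * w) * g) / (s * w' / w).
Proof. by move=> w0 w'0; field; rewrite w0 w'0 s0. Qed.

Lemma fixpoint_cancel2 (w w' g : F) :
  w != 0 -> w' != 0 -> s ^+ 2 * g / (s ^+ 2 * w' / w) = w / w' * g.
Proof. by move=> w0 w'0; field; rewrite w0 w'0 s0. Qed.

End ClosedForm.

(** * Generating functions of the counts *)

Section GeneratingFunctions.

Variables (R : realType) (W : nat -> {fraction {poly R}}).
Let s : {fraction {poly R}} := sqrtx R.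
Hypotheses (W0 : W 0 = 0) (W1 : W 1 = 1).
Hypothesis Wrec : forall m, W m.+2 = W m.+1 / s - W m.
Hypothesis Wneq0 : forall m, W m.+1 != 0.

Lemma sqrtx_neq0 : s != 0.
Proof. by rewrite tofrac_eq0 polyX_eq0. Qed.

Lemma tofrac_natr (n : nat) : tofrac (n%:R : R)%:P = n%:R.
Proof. by rewrite polyC_natr rmorph_nat. Qed.

(** In the recurrence for G_(m+1,j) the term a = 0 contains the unknown itself, with known factor
    G_(m,0); the terms a >= 1 involve only G_(m+1,j-a). Hence induction on m and strong induction on
    j, solving one linear equation each time. *)
Lemma gf_num_inc m j : gf (fun n => (num_inc m j n)%:R : R) (inc_closed s W m j).
Proof.
elim: m j => [|m IHm] j.
  have -> : inc_closed s W 0 j = tofrac ((j == 1)%N%:R : R)%:P * s ^+ 2 ^+ 0.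
    rewrite expr0 mulr1 tofrac_natr; case: j => [|[|j]] /=; rewrite W0 ?mulr0 ?mul0r //.
      by rewrite W1 expr0 expr1n divr1.
    by rewrite exprS !mul0r.
  apply: eq_gf (gf_monomial 0 _) => n; rewrite num_inc0 /monomial.
  by case: (n == 0)%N; rewrite ?andbT ?andbF.
elim/ltn_ind: j => j IHj.
pose d (n : nat) : R := monomial 0 (j == 0)%:R n +
  \sum_(0 <= i < j) shift (conv (fun n => (num_inc m i.+1 n)%:R)
                                   (fun n => (num_inc m.+1 (j - i.+1) n)%:R)) n.
pose h := (j == 0)%:R + \sum_(0 <= i < j)
  s ^+ 2 * (inc_closed s W m i.+1 * inc_closed s W m.+1 (j - i.+1)).
have dh : gf d h.
  apply: gfD.
    by have := gf_monomial 0 ((j == 0)%:R : R); rewrite expr0 mulr1 tofrac_natr.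
  apply: gf_sum => i; rewrite mem_index_iota => ij.
  by apply: gf_shift; apply: gf_conv => //; apply: IHj; lia.
have f0 : 1 - s ^+ 2 * inc_closed s W m 0 != 0.
  exact: (one_sub_inc_closed_neq0 sqrtx_neq0 Wrec Wneq0).
have -> : inc_closed s W m.+1 j = h / (1 - s ^+ 2 * inc_closed s W m 0).
  rewrite (one_sub_inc_closed sqrtx_neq0 Wrec Wneq0) /h big_mkord.
  case: j {IHj d h dh} => [|j].
    by rewrite big_ord0 addr0 /= invf_div mul1r.
  rewrite add0r -big_distrr /=.
  under eq_bigr do rewrite subSS.
  rewrite (inc_closed_conv sqrtx_neq0 W0 W1 Wrec Wneq0).
  exact: (fixpoint_cancel sqrtx_neq0 _ (Wneq0 m) (Wneq0 m.+1)).
apply: (gf_fixpoint (IHm 0%N) dh f0).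
  by rewrite num_inc_succ0 /d /monomial eqxx big1 ?addr0 // => i _.
move=> n; rewrite num_inc_succ /d /monomial /= add0r big_ord_recl natrD addrC.
rewrite big_mkord; congr (_ + _).
  rewrite natr_sum; apply: eq_bigr => i _; rewrite lift0 /conv natr_sum.
  by apply: eq_bigr => a _; rewrite natrM.
rewrite /conv natr_sum; apply: eq_bigr => a _; by rewrite natrM subn0.
Qed.

Lemma gf_num_occ k r : (1 <= r <= k.+1)%N ->
  gf (fun n => (num_occ k.+2 r n)%:R : R)
     (W k.+1 / W k.+3 * \sum_(l <- divisors r)
        inc_closed s W k (r %/ l) * ((num_av l)%:R * s ^+ 2 ^+ l)).
Proof.
move=> hr.
(* The coefficient of the unknown: the monomial 1 accounts for the empty right factor, [num_inc k 0]
   for left factors without increasing words of length k. *)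
pose b (n : nat) : R := monomial 0 1 n + (num_inc k 0 n)%:R.
pose d : nat -> R := shift (fun n => \sum_(l <- divisors r)
  conv (fun n => (num_inc k (r %/ l) n)%:R) (monomial l (num_av l)%:R) n).
have bf : gf b (1 + inc_closed s W k 0).
  apply: gfD; last exact: gf_num_inc.
  by have := @gf_monomial R 0 1; rewrite rmorph1 mul1r expr0.
have dh : gf d (s ^+ 2 * \sum_(l <- divisors r)
        inc_closed s W k (r %/ l) * ((num_av l)%:R * s ^+ 2 ^+ l)).
  apply/gf_shift/gf_sum => l _; apply: gf_conv; first exact: gf_num_inc.
  by rewrite -tofrac_natr; exact: gf_monomial.
have E := one_sub_inc_closed1 sqrtx_neq0 Wrec Wneq0 k.
have f0 : 1 - s ^+ 2 * (1 + inc_closed s W k 0) != 0.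
  exact: (one_sub_inc_closed1_neq0 sqrtx_neq0 Wrec Wneq0).
have := gf_fixpoint (a := fun n => (num_occ k.+2 r n)%:R) bf dh f0.
rewrite E; set S := \sum_(l <- _) _.
have -> : s ^+ 2 * S / (s ^+ 2 * W k.+3 / W k.+1) = W k.+1 / W k.+3 * S.
  exact: (fixpoint_cancel2 sqrtx_neq0 _ (Wneq0 k) (Wneq0 k.+2)).
apply; first by rewrite num_occ0 //; case/andP: hr.
move=> n; rewrite num_occ_succ // !natrD addrC; congr (_ + _).
  rewrite /d /= natr_sum; apply: eq_bigr => l _; rewrite natr_sum /conv.
  by apply: eq_bigr => i _; rewrite natrM /monomial; case: eqP.
have -> : conv b (fun n => (num_occ k.+2 r n)%:R) n =
    conv (monomial 0 1) (fun n => (num_occ k.+2 r n)%:R) n +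
    conv (fun n => (num_inc k 0 n)%:R) (fun n => (num_occ k.+2 r n)%:R) n.
  by rewrite /conv -big_split /=; apply: eq_bigr => i _; rewrite mulrDl.
rewrite conv_monomial /= mul1r subn0; congr (_ + _).
by rewrite natr_sum; apply: eq_bigr => i _; rewrite natrM.
Qed.

End GeneratingFunctions.

(** * Chebyshev polynomials *)

Lemma dvdn_div_gt0 (l r : nat) : (0 < r -> l %| r -> 0 < r %/ l)%N.
Proof. by move=> r0 lr; rewrite divn_gt0 ?(dvdn_gt0 r0 lr) // dvdn_leq. Qed.

(** One divisor's summand: y, c, d, e stand for x^l, the Catalan number, l+1 and the central
    binomial, and q for r/l. *)
Lemma inc_closed_term (F : fieldType) (s : F) (W : nat -> F) k q (y c d e : F) :
  s != 0 -> W k != 0 -> W k.+1 != 0 -> W k.+3 != 0 -> (0 < q)%N ->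
  d != 0 -> d * c = e ->
  W k.+1 / W k.+3 * (inc_closed s W k q * (c * y)) =
  1 / (W k * W k.+3) * (1 / d * e * (y * s ^+ q / s) * (W k / W k.+1) ^+ q).
Proof.
case: q => // q s0 w0 w1 w3 _ d0 <-; rewrite /= !exprMn !exprVn !(exprS _ q).
move: (s ^+ q) (W k ^+ q) (expf_neq0 q w1) => a b; move: (W k.+1 ^+ q) => z z0.
field.
by rewrite s0 w0 w1 w3 z0 d0.
Qed.

(** The summand for r = 1. No division by [W k] occurs, so this covers k = 0, where [W k]
    vanishes. *)
Lemma inc_closed_one (F : fieldType) (s : F) (W : nat -> F) k (y : F) :
  W k.+1 != 0 -> W k.+3 != 0 ->
  W k.+1 / W k.+3 * (inc_closed s W k 1 * (1 * y ^+ 1)) = y / (W k.+1 * W k.+3).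
Proof. by move=> w1 w3; rewrite /= expr0; field; rewrite w1 w3. Qed.

Lemma chebyshev_step_scaled (F : fieldType) (s v v' : F) n : s != 0 ->
  (v' / s - v) * s ^+ n.+2 = v' * s ^+ n.+1 - s ^+ 2 * (v * s ^+ n).
Proof. by move=> s0; rewrite !exprS expr0; move: (s ^+ n) => a; field. Qed.

Section Chebyshev.

Variables (R : realType) (U : nat -> {poly R}).
Hypothesis hU : forall n : nat, is_chebyshevU n (U n).
Notation V n := (at_half_inv_sqrtx (U n)).

Lemma chebyshevU_pairE m : U m = (chebyshevU_pair R m).1.
Proof. by apply: (@is_chebyshevU_inj R m); last exact: is_chebyshevU_ex. Qed.

Lemma chebyshevU_rec n : U n.+2 = 2 *: 'X * U n.+1 - U n.
Proof.
by rewrite !chebyshevU_pairE /=; case: (chebyshevU_pair R n).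
Qed.

Lemma at_half_inv_sqrtx_U0 : V 0 = 1.
Proof.
rewrite chebyshevU_pairE /=.
rewrite /at_half_inv_sqrtx -[map_poly _]/(map_poly (@tofrac {poly R} \o polyC)).
by rewrite rmorph1 hornerC.
Qed.

Lemma half_half_inv_sqrtx : tofrac (2 : R)%:P * (2 * sqrtx R)^-1 = (sqrtx R)^-1.
Proof.
have n2 : (2 : {fraction {poly R}}) != 0.
  by rewrite -(rmorph_nat (@tofrac _)) tofrac_eq0 -polyC_natr polyC_eq0 pnatr_eq0.
by rewrite polyC_natr rmorph_nat invfM mulrA divff ?mul1r.
Qed.

Lemma at_half_inv_sqrtx_U1 : V 1 = (sqrtx R)^-1.
Proof.
rewrite chebyshevU_pairE /=.
rewrite /at_half_inv_sqrtx -[map_poly _]/(map_poly (@tofrac {poly R} \o polyC)).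
by rewrite map_polyZ map_polyX hornerZ hornerX half_half_inv_sqrtx.
Qed.

Lemma at_half_inv_sqrtx_rec n : V n.+2 = V n.+1 / sqrtx R - V n.
Proof.
rewrite chebyshevU_rec /at_half_inv_sqrtx -[map_poly _]/(map_poly (@tofrac {poly R} \o polyC)).
rewrite rmorphB rmorphM /= map_polyZ map_polyX hornerD hornerN hornerM hornerZ hornerX.
by rewrite half_half_inv_sqrtx mulrC.
Qed.

(** By the recurrence, s^n U_n(1/(2s)) is a polynomial in s with constant term 1. *)
Lemma at_half_inv_sqrtx_U_neq0 n : V n != 0.
Proof.
have key m : exists2 w : {poly R}, w`_0 = 1 & V m * sqrtx R ^+ m = tofrac w.
  suff: (exists2 w : {poly R}, w`_0 = 1 & V m * sqrtx R ^+ m = tofrac w) /\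
        (exists2 w : {poly R}, w`_0 = 1 & V m.+1 * sqrtx R ^+ m.+1 = tofrac w) by case.
  elim: m => [|m [[w w1 wE] [w' w'1 w'E]]].
    split; exists 1; rewrite ?coef1 //.
      by rewrite at_half_inv_sqrtx_U0 mul1r rmorph1.
    by rewrite at_half_inv_sqrtx_U1 expr1 mulVf ?sqrtx_neq0 // rmorph1.
  split; first by exists w'.
  exists (w' - 'X^2 * w); first by rewrite coefB coefXnM w'1 subr0.
  rewrite at_half_inv_sqrtx_rec chebyshev_step_scaled ?sqrtx_neq0 // wE w'E.
  by rewrite rmorphB rmorphM rmorphXn.
have [w w1 wE] := key n; apply/eqP => V0.
move/eqP: wE; rewrite V0 mul0r eq_sym tofrac_eq0 => /eqP w0.
by move/eqP: w1; rewrite w0 coef0 eq_sym oner_eq0.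
Qed.

End Chebyshev.

Theorem theorem7 (R : realType) (U : nat -> {poly R})
    (hU : forall n : nat, is_chebyshevU n (U n)) (k : nat) (hk : (2 <= k)%N) :
  let s : {fraction {poly R}} := sqrtx R in
  let x : {fraction {poly R}} := s ^+ 2 in
  let V (n : nat) : {fraction {poly R}} := at_half_inv_sqrtx (U n) in
  is_generating_function (num_perms k 1) (x / (V (k - 2)%N * V k)) /\
  ((3 <= k)%N ->
   forall r : nat, (1 <= r)%N -> (r <= k - 1)%N ->
   is_generating_function (num_perms k r)
     (1 / (V (k - 3)%N * V k) *
      \sum_(l <- divisors r)
         (1 / l.+1%:R) * ('C(2 * l, l))%:R *
         (x ^+ l * s ^+ (r %/ l) / s) *
         (V (k - 3)%N / V (k - 2)%N) ^+ (r %/ l))).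
Proof.
move=> s x V; case: k hk => [|[|k]] // _.
(* The shifted index adds U_(-1) = 0, so that patterns of length 2 need no separate treatment. *)
pose W m := if m is m'.+1 then V m' else 0.
have W1 : W 1 = 1 by exact: at_half_inv_sqrtx_U0.
have Wrec m : W m.+2 = W m.+1 / s - W m.
  case: m => [|m]; last exact: at_half_inv_sqrtx_rec.
  by rewrite /= subr0 /V at_half_inv_sqrtx_U0 // at_half_inv_sqrtx_U1 // mul1r.
have Wneq0 m : W m.+1 != 0 by exact: at_half_inv_sqrtx_U_neq0.
have main r f : (1 <= r <= k.+1)%N ->
    W k.+1 / W k.+3 * (\sum_(l <- divisors r)
      inc_closed s W k (r %/ l) * ((num_av l)%:R * x ^+ l)) = f ->
    is_generating_function (num_perms k.+2 r) f.
  move=> hr <-; rewrite -[is_generating_function _ _]/(gf (fun n => (num_perms k.+2 r n)%:R) _).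
  apply: eq_gf (@gf_num_occ R W erefl W1 Wrec Wneq0 k r hr) => n.
  by rewrite num_permsE.
split.
  apply: main => //; rewrite subn2 big_seq1 divn1 (_ : num_av 1 = 1%N) //.
  exact: (inc_closed_one _ _ (Wneq0 k) (Wneq0 k.+2)).
(* The formula for general r divides by U_(k-3), which here is [W k]; the pattern has length at
   least 3, so this index is positive and [W k] is nonzero. *)
case: k @W W1 Wrec Wneq0 main => // k W W1 Wrec Wneq0 main _ r r1 rk.
apply: main; first by rewrite r1; move: rk; rewrite subn1.
rewrite !big_distrr /= big_seq [RHS]big_seq; apply: eq_bigr => l hl.
have lr : (l %| r)%N by rewrite dvdn_divisors.
have q0 := dvdn_div_gt0 r1 lr.
have d0 : l.+1%:R != 0 :> {fraction {poly R}}.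
  by rewrite -tofrac_natr tofrac_eq0 polyC_eq0 pnatr_eq0.
have de : l.+1%:R * (num_av l)%:R = 'C(2 * l, l)%:R :> {fraction {poly R}}.
  by rewrite -natrM num_av_bin.
rewrite !subSS !subn0.
exact: (inc_closed_term _ (sqrtx_neq0 R) (Wneq0 k) (Wneq0 k.+1) (Wneq0 k.+3) q0 d0 de).
Qed.
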